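(* Two-sided golden transmutations share the properties of an equivalence relation. More precisely: (i) Any linear mapping $A$ is a two-sided golden transmutation of itself by $(\mathrm{Id},\mathrm{Id},\mathrm{Id},\mathrm{Id},0,0)$. (ii) If $A$ is a two-sided golden transmutation of $B$ by $(P,Q,R,S,T,\tilde T)$, then $B$ is a two-sided golden transmutation of $A$ by $(Q,P,S,R,\tilde T,T)$. (iii) If $A$ is a two-sided golden transmutation of $B$ by $(P_1,Q_1,R_1,S_1,T_1,\tilde T_1)$ and $B$ is a two-sided golden transmutation of $C$ by $(P_2,Q_2,R_2,S_2,T_2,\tilde T_2)$, then $A$ is a two-sided golden transmutation of $C$ by $$\big(P_1P_2,\;Q_2Q_1,\;R_1R_2,\;S_2S_1,\;T_1+P_1T_2S_1,\;\tilde T_2+Q_2\tilde T_1R_2\big).$$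
   Context: $L(\mathcal X;\mathcal Y)$ denotes the space of linear mappings from the vector space $\mathcal X$ to the vector space $\mathcal Y$. For vector spaces $\mathcal E,\mathcal F,\mathcal G,\mathcal H$ and $A\in L(\mathcal E;\mathcal F)$, $B\in L(\mathcal G;\mathcal H)$, $P\in L(\mathcal G;\mathcal E)$, $Q\in L(\mathcal E;\mathcal G)$, $R\in L(\mathcal H;\mathcal F)$, $S\in L(\mathcal F;\mathcal H)$, $T\in L(\mathcal F;\mathcal E)$, $\tilde T\in L(\mathcal H;\mathcal G)$, one says that $A$ is a two-sided golden transmutation of $B$ by $(P,Q,R,S,T,\tilde T)$ if $AP=RB$, $BQ=SA$, $PQ+TA=\mathrm{Id}_{\mathcal E}$, $RS+AT=\mathrm{Id}_{\mathcal F}$, $QP+\tilde TB=\mathrm{Id}_{\mathcal G}$ and $SR+B\tilde T=\mathrm{Id}_{\mathcal H}$. *)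

(* Defs.v *)
From HB Require Import structures.
From mathcomp Require Import all_boot all_order all_algebra.

Set Implicit Arguments.
Unset Strict Implicit.
Unset Printing Implicit Defensive.

Import GRing.Theory.
Local Open Scope ring_scope.

(* Vector spaces are left modules over a field, of arbitrary dimension.
   Equality of linear maps is pointwise equality [=1]; [T'] is \tilde T. *)
Definition two_sided_golden_transmutation (K : fieldType) (E F G H : lmodType K)
    (A : {linear E -> F}) (B : {linear G -> H})
    (P : {linear G -> E}) (Q : {linear E -> G})
    (R : {linear H -> F}) (S : {linear F -> H})
    (T : {linear F -> E}) (T' : {linear H -> G}) : Prop :=
  [/\ A \o P =1 R \o B /\ B \o Q =1 S \o A,
      (P \o Q) \+ (T \o A) =1 idfun,
      (R \o S) \+ (A \o T) =1 idfun,
      (Q \o P) \+ (T' \o B) =1 idfun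
    & (S \o R) \+ (B \o T') =1 idfun].

(* Main.v *)
Require Import Defs.
From HB Require Import structures.
From mathcomp Require Import all_boot all_order all_algebra.

Set Implicit Arguments.
Unset Strict Implicit.
Unset Printing Implicit Defensive.

Import GRing.Theory.
Local Open Scope ring_scope.

(** View [A] and [B] as two-term complexes. The intertwining relations make [(P, R)] and [(Q, S)]
    chain maps, and the other four say that they are mutually inverse up to the homotopies [T] and
    [T']: a homotopy equivalence. Identities with zero homotopy give (i), exchanging the two sides
    gives (ii), and composition gives (iii), where the inner homotopy is transported by the outer
    chain maps, as in [P1 \o T2 \o S1]. *)

Theorem theorem2p13 (K : fieldType) :
  [/\ (forall (E F : lmodType K) (A : {linear E -> F}),
        two_sided_golden_transmutation A A idfun idfun idfun idfun \0 \0),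
      (forall (E F G H : lmodType K)
          (A : {linear E -> F}) (B : {linear G -> H})
          (P : {linear G -> E}) (Q : {linear E -> G})
          (R : {linear H -> F}) (S : {linear F -> H})
          (T : {linear F -> E}) (T' : {linear H -> G}),
        two_sided_golden_transmutation A B P Q R S T T' ->
        two_sided_golden_transmutation B A Q P S R T' T)
    & (forall (E F G H M N : lmodType K)
          (A : {linear E -> F}) (B : {linear G -> H}) (C : {linear M -> N})
          (P1 : {linear G -> E}) (Q1 : {linear E -> G})
          (R1 : {linear H -> F}) (S1 : {linear F -> H})
          (T1 : {linear F -> E}) (T1' : {linear H -> G})
          (P2 : {linear M -> G}) (Q2 : {linear G -> M})
          (R2 : {linear N -> H}) (S2 : {linear H -> N})
          (T2 : {linear H -> G}) (T2' : {linear N -> M}),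
        two_sided_golden_transmutation A B P1 Q1 R1 S1 T1 T1' ->
        two_sided_golden_transmutation B C P2 Q2 R2 S2 T2 T2' ->
        two_sided_golden_transmutation A C
          (P1 \o P2) (Q2 \o Q1) (R1 \o R2) (S2 \o S1)
          (T1 \+ (P1 \o T2 \o S1)) (T2' \+ (Q2 \o T1' \o R2)))].
Proof.
split.
- by move=> E F A; split=> [|x|x|x|x] //=; rewrite ?raddf0 addr0.
(* The six identities are merely permuted. *)
- by move=> E F G H A B P Q R S T T' [[AP BQ] PQ RS QP SR].
(* In each identity, conjugating the inner relation, e.g.
   P1 (P2 Q2 + T2 B) Q1 = P1 Q1, and using an intertwining relation such as
   B Q1 = S1 A, reduces the composite to the outer relation. *)
- move=> E F G H M N A B C P1 Q1 R1 S1 T1 T1' P2 Q2 R2 S2 T2 T2'.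
  move=> [[AP1 BQ1] PQ1 RS1 QP1 SR1] [[BP2 CQ2] PQ2 RS2 QP2 SR2].
  split; first split; move=> x /=.
  + by rewrite [LHS]AP1; congr (R1 _); apply: BP2.
  + by rewrite [LHS]CQ2; congr (S2 _); apply: BQ1.
  + have /= <- := BQ1 x; rewrite addrCA -raddfD.
    by have /= -> := PQ2 (Q1 x); rewrite addrC; apply: PQ1.
  (* Here [A] acts after the homotopy, so it is first distributed over the sum, then moved past
     [P1]. *)
  + rewrite raddfD; have /= -> := AP1 (T2 (S1 x)); rewrite addrCA -raddfD.
    by have /= -> := RS2 (S1 x); rewrite addrC; apply: RS1.
  (* On the side of [C] the roles swap: the first transmutation is now the inner one, conjugated by
     [Q2] and [P2]. *)
  + have /= <- := BP2 x; rewrite addrCA -raddfD.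
    by have /= -> := QP1 (P2 x); rewrite addrC; apply: QP2.
  + rewrite raddfD; have /= -> := CQ2 (T1' (R2 x)); rewrite addrCA -raddfD.
    by have /= -> := SR1 (R2 x); rewrite addrC; apply: SR2.
Qed.
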